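(* Let $\mathfrak g$ be a restricted Lie algebra over $\mathbb F$ and let $M$ and $N$ be restricted $\mathfrak g$-modules. Then the set $\operatorname{Ext}(N,M)$ of equivalence classes of restricted extensions of $N$ by $M$ is in one-to-one correspondence with $H^1(\mathfrak g;\operatorname{Hom}_{\mathbb F}(N,M))$.
   Context: $\mathbb F$ is a field of characteristic $p>0$. Left-normed brackets: $[g_1,g_2,\dots,g_k]=[[\cdots[[g_1,g_2],g_3]\cdots],g_k]$. A restricted Lie algebra is a Lie algebra $\mathfrak g$ over $\mathbb F$ with a map $g\mapsto g^{[p]}$ such that $(\lambda g)^{[p]}=\lambda^pg^{[p]}$; $(g+h)^{[p]}=g^{[p]}+h^{[p]}+\sum\frac1{\#(g)}[g_1,\dots,g_p]$, the sum over words $(g_1,\dots,g_p)$ in the letters $g,h$ with $g_1=g$, $g_2=h$, where $\#(g)$ is the number of letters $g$ in the word; and $[g,h^{[p]}]=[g,h,\dots,h]$ ($p$ copies of $h$). A restricted $\mathfrak g$-module is a $\mathfrak g$-module $M$ with $g^{[p]}x=g^px$ for all $g,x$. A restricted extension of $N$ by $M$ is an exact sequence $0\to M\xrightarrow{\iota}E\xrightarrow{\pi}N\to0$ of restricted $\mathfrak g$-modules and homomorphisms. Two extensions $E_1,E_2$ are equivalent if there is a $\mathfrak g$-module homomorphism $E_1\to E_2$ compatible with the identity maps of $M$ and $N$ (commutative diagram). $\operatorname{Hom}_{\mathbb F}(N,M)$ is a restricted $\mathfrak g$-module by $(g\phi)(n)=g\phi(n)-\phi(gn)$. For a restricted $\mathfrak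 g$-module $V$, let $C^0(\mathfrak g;V)=V$, $C^1(\mathfrak g;V)=\operatorname{Hom}_{\mathbb F}(\mathfrak g,V)$, $\delta^0(v)(g)=-gv$, and $\delta^1\psi=(\delta_{\rm cl.}\psi,\tilde\psi)$, where $\delta_{\rm cl.}\psi(g,h)=-g\psi(h)+h\psi(g)+\psi([g,h])$ and $\tilde\psi(g)=\psi(g^{[p]})-g^{p-1}\psi(g)$. Then $H^1(\mathfrak g;V)=\ker\delta^1/\operatorname{im}\delta^0$. The correspondence meant is the one assigning to an extension the class of the cocycle $\psi(g)(n)=g\rho(n)-\rho(gn)\in M$, where $\rho:N\to E$ is any $\mathbb F$-linear map with $\pi\rho=1_N$. *)

(* Defs.v *)
From HB Require Import structures.
From mathcomp Require Import all_boot all_algebra.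
From mathcomp Require Import all_classical.

Set Implicit Arguments.
Unset Strict Implicit.
Unset Printing Implicit Defensive.

Import GRing.Theory.
Local Open Scope ring_scope.

HB.mixin Record isLieAlgebra (F : fieldType) L of GRing.Lmodule F L := {
  lie : L -> L -> L;
  lie_linearl : forall h, linear (lie^~ h);
  lie_linearr : forall g, linear (lie g);
  lie_alt : forall g, lie g g = 0;
  lie_jacobi : forall f g h,
    lie f (lie g h) + lie g (lie h f) + lie h (lie f g) = 0
}.

#[short(type="lieAlgType")]
HB.structure Definition LieAlgebra (F : fieldType) :=
  {L of GRing.Lmodule F L & isLieAlgebra F L}.

(* The left-normed bracket [g_1, g_2, ..., g_k]. *)
Definition lnlie (F : fieldType) (L : lieAlgType F) (s : seq L) : L :=
  if s is g :: s' then foldl lie g s' else 0.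

(* In [ppowD] a word in two formal letters is a tuple of booleans: true stands
   for the letter g and false for the letter h, so that the letters are told
   apart even when g = h.  A word starting with g, h contains between 1 and
   p - 1 letters g, so the inverted scalar is nonzero in F. *)
HB.mixin Record isRestrictedLie (F : fieldType) (p : nat)
    (charFp : p \in [pchar F]) L of LieAlgebra F L := {
  ppow : L -> L;
  ppowZ : forall (a : F) (g : L), ppow (a *: g) = a ^+ p *: ppow g;
  ppowD : forall g h : L,
    ppow (g + h) = ppow g + ppow h +
      \sum_(w : p.-tuple bool | nth false w 0 && ~~ nth true w 1)
         ((count_mem true w)%:R : F)^-1 *:
           lnlie [seq (if b then g else h) | b <- w];
  lie_ppow : forall g h : L, lie g (ppow h) = lnlie (g :: nseq p h)
}.

#[short(type="restrictedLieType")]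
HB.structure Definition RestrictedLie (F : fieldType) (p : nat)
    (charFp : p \in [pchar F]) :=
  {L of LieAlgebra F L & isRestrictedLie F p charFp L}.

HB.mixin Record isLieModule (F : fieldType) (L : lieAlgType F) M
    of GRing.Lmodule F M := {
  act : L -> M -> M;
  act_linearl : forall x, linear (act^~ x);
  act_linearr : forall g, linear (act g);
  act_lie : forall g h x, act (lie g h) x = act g (act h x) - act h (act g x)
}.

#[short(type="lieModType")]
HB.structure Definition LieModule (F : fieldType) (L : lieAlgType F) :=
  {M of GRing.Lmodule F M & isLieModule F L M}.

HB.mixin Record isRestrictedModule (F : fieldType) (p : nat)
    (charFp : p \in [pchar F]) (L : restrictedLieType charFp) M
    of LieModule F L M := {
  act_ppow : forall (g : L) (x : M), act (ppow g) x = iter p (act g) x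
}.

#[short(type="restrictedModType")]
HB.structure Definition RestrictedModule (F : fieldType) (p : nat)
    (charFp : p \in [pchar F]) (L : restrictedLieType charFp) :=
  {M of LieModule F L M & isRestrictedModule F p charFp L M}.

HB.instance Definition _ (F : fieldType) (L : lieAlgType F) (g : L) :=
  GRing.isLinear.Build F L L *:%R (lie g) (lie_linearr g).
HB.instance Definition _ (F : fieldType) (L : lieAlgType F)
    (M : lieModType L) (g : L) :=
  GRing.isLinear.Build F M M *:%R (act g) (act_linearr g).

Section ActTheory.
Variables (F : fieldType) (L : lieAlgType F) (M : lieModType L).
Implicit Types (g h : L) (x y : M) (a : F).

Lemma actBr g x y : act g (x - y) = act g x - act g y.
Proof. exact: linearB. Qed.

Lemma actDl g h x : act (g + h) x = act g x + act h x.
Proof. by have := act_linearl x 1 g h; rewrite /= !scale1r. Qed.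

Lemma act0l x : act (0 : L) x = 0.
Proof. by apply: (addIr (act (0 : L) x)); rewrite -actDl !add0r. Qed.

Lemma actZl a g x : act (a *: g) x = a *: act g x.
Proof. by have := act_linearl x a g 0; rewrite /= act0l !addr0. Qed.

End ActTheory.

Section LinearMaps.
Variables (F : fieldType) (U V : lmodType F).
Implicit Types f g h : {linear U -> V}.

Lemma linear_ext f g : f =1 g -> f = g.
Proof.
case: f g => [f cf] [g cg] /= /funext fg; subst g.
case: cf cg => [[a1] [b1]] [[a2] [b2]].
by rewrite (Prop_irrelevance a1 a2) (Prop_irrelevance b1 b2).
Qed.

HB.instance Definition _ := gen_eqMixin {linear U -> V}.
HB.instance Definition _ := gen_choiceMixin {linear U -> V}.

Definition lin_add f g : {linear U -> V} := f \+ g.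
Definition lin_opp f : {linear U -> V} := \- f.
Definition lin_zero : {linear U -> V} := \0.
Definition lin_scale (a : F) f : {linear U -> V} := a \*: f.

Lemma lin_addA : associative lin_add.
Proof. by move=> f g h; apply: linear_ext => x /=; rewrite addrA. Qed.
Lemma lin_addC : commutative lin_add.
Proof. by move=> f g; apply: linear_ext => x /=; rewrite addrC. Qed.
Lemma lin_add0 : left_id lin_zero lin_add.
Proof. by move=> f; apply: linear_ext => x /=; rewrite add0r. Qed.
Lemma lin_addN : left_inverse lin_zero lin_opp lin_add.
Proof. by move=> f; apply: linear_ext => x /=; rewrite addNr. Qed.

HB.instance Definition _ :=
  GRing.isZmodule.Build {linear U -> V} lin_addA lin_addC lin_add0 lin_addN.

Lemma lin_scaleA a b f : lin_scale a (lin_scale b f) = lin_scale (a * b) f.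
Proof. by apply: linear_ext => x /=; rewrite scalerA. Qed.
Lemma lin_scale1 : left_id 1 lin_scale.
Proof. by move=> f; apply: linear_ext => x /=; rewrite scale1r. Qed.
Lemma lin_scaleDr : right_distributive lin_scale +%R.
Proof. by move=> a f g; apply: linear_ext => x /=; rewrite scalerDr. Qed.
Lemma lin_scaleDl f : {morph lin_scale^~ f : a b / a + b}.
Proof. by move=> a b; apply: linear_ext => x /=; rewrite scalerDl. Qed.

HB.instance Definition _ := GRing.Zmodule_isLmodule.Build F {linear U -> V}
  lin_scaleA lin_scale1 lin_scaleDr lin_scaleDl.

Lemma linDE f g x : (f + g) x = f x + g x. Proof. by []. Qed.
Lemma linNE f x : (- f) x = - f x. Proof. by []. Qed.
Lemma linBE f g x : (f - g) x = f x - g x. Proof. by []. Qed.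
Lemma lin0E x : (0 : {linear U -> V}) x = 0. Proof. by []. Qed.
Lemma linZE (a : F) f x : (a *: f) x = a *: f x. Proof. by []. Qed.

End LinearMaps.

Section HomLieModule.
Variables (F : fieldType) (L : lieAlgType F) (N M : lieModType L).
Implicit Types (g h : L) (phi : {linear N -> M}).

Definition hom_act_fun g phi (n : N) : M := act g (phi n) - phi (act g n).

Lemma hom_act_linear g phi : linear (hom_act_fun g phi).
Proof.
move=> a x y; rewrite /hom_act_fun !linearP /= scalerBr -scalerN.
by rewrite addrACA.
Qed.

HB.instance Definition _ g phi :=
  GRing.isLinear.Build F N M *:%R (hom_act_fun g phi) (hom_act_linear g phi).

Definition hom_act g phi : {linear N -> M} := hom_act_fun g phi.

Lemma hom_actE g phi n : hom_act g phi n = act g (phi n) - phi (act g n).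
Proof. by []. Qed.

Lemma hom_act_linearl phi : linear (hom_act^~ phi).
Proof.
move=> a g h; apply: linear_ext => n.
rewrite linDE linZE !hom_actE !actDl !actZl !linearP /= scalerBr -scalerN.
by rewrite addrACA.
Qed.

Lemma hom_act_linearr g : linear (hom_act g).
Proof.
move=> a phi psi; apply: linear_ext => n.
rewrite linDE linZE !hom_actE !linDE !linZE !linearP /= scalerBr -scalerN.
by rewrite addrACA.
Qed.

Lemma hom_act_lie g h phi :
  hom_act (lie g h) phi = hom_act g (hom_act h phi) - hom_act h (hom_act g phi).
Proof.
apply: linear_ext => n; rewrite linBE !hom_actE !act_lie !actBr (linearB phi).
rewrite !opprB [RHS]addrACA !addrA !subrK.
by rewrite -!addrA [in RHS](addrC (- phi _)) -addrA [in LHS](addrCA (- _)).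
Qed.

HB.instance Definition _ := isLieModule.Build F L {linear N -> M}
  hom_act_linearl hom_act_linearr hom_act_lie.

Lemma act_homE g phi n : act g phi n = act g (phi n) - phi (act g n).
Proof. by []. Qed.

End HomLieModule.

Lemma pchar_binomial_sum (F : fieldType) (V : lmodType F) (p : nat)
    (charFp : p \in [pchar F]) (G : nat -> V) :
  \sum_(i < p.+1) ((-1) ^+ i *+ 'C(p, i) : F) *: G i = G 0 - G p.
Proof.
have: (0 < p)%N by rewrite prime_gt0 // (pcharf_prime charFp).
case: p charFp => // q chq _.
rewrite big_ord_recl big_ord_recr /= big1 ?add0r.
  rewrite /bump /= add1n bin0 binn expr0 !mulr1n scale1r.
  have -> : (-1) ^+ q.+1 = -1 :> F.
    by rewrite -(pFrobenius_autE chq) pFrobenius_autN pFrobenius_aut1.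
  by rewrite scaleN1r.
move=> i _; rewrite /bump /= add1n.
have /dvdnP[c ->] : (q.+1 %| 'C(q.+1, i.+1))%N.
  by rewrite prime_dvd_bin ?(pcharf_prime chq) //= ltnS ltn_ord.
by rewrite mulnC mulrnA (mulrn_pchar chq) mul0rn scale0r.
Qed.

Section HomRestrictedModule.
Variables (F : fieldType) (p : nat) (charFp : p \in [pchar F]).
Variables (L : restrictedLieType charFp) (N M : restrictedModType L).
Implicit Types (g : L) (phi : {linear N -> M}).

Lemma iter_act_sum g phi k n :
  iter k (act g) phi n =
  \sum_(i < k.+1) ((-1) ^+ i *+ 'C(k, i) : F) *:
      iter (k - i) (act g) (phi (iter i (act g) n)).
Proof.
elim: k n => [|k IHk] n.
  by rewrite big_ord1 /= expr0 bin0 mulr1n scale1r.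
rewrite iterS act_homE !IHk.
rewrite linear_sum [in RHS]big_ord_recl /= [X in X - _]big_ord_recl /=.
rewrite !bin0 !subn0 expr0 !mulr1n !scale1r -addrA; congr (_ + _).
rewrite -sumrN [X in X + _](_ : _ = \sum_(i < k.+1)
    ((-1) ^+ i.+1 *+ 'C(k, i.+1) : F) *:
      iter (k - i) (act g) (phi (iter i.+1 (act g) n))).
  rewrite -big_split /=; apply: eq_bigr => i _.
  rewrite -iterSr -iterS /bump /= add1n subSS binS mulrnDr scalerDl.
  by congr (_ + _); rewrite -scaleNr exprS mulN1r mulNrn.
rewrite [RHS]big_ord_recr /= bin_small // mulr0n scale0r addr0.
apply: eq_bigr => i _; rewrite linearZ_LR /= /bump /= add1n.
by rewrite -iterS -subSn // subSS.
Qed.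

Lemma hom_act_ppow g phi : act (ppow g) phi = iter p (act g) phi.
Proof.
apply: linear_ext => n; rewrite iter_act_sum act_homE !act_ppow.
pose G i := iter (p - i) (act g) (phi (iter i (act g) n)).
by rewrite (pchar_binomial_sum charFp G) /G subn0 subnn.
Qed.

HB.instance Definition _ :=
  isRestrictedModule.Build F p charFp L {linear N -> M} hom_act_ppow.

End HomRestrictedModule.

Section Cohomology.
Variables (F : fieldType) (p : nat) (charFp : p \in [pchar F]).
Variables (L : restrictedLieType charFp) (V : restrictedModType L).
Implicit Types (g h : L) (v : V) (psi : {linear L -> V}).

Definition delta0_fun v g : V := - act g v.

Lemma delta0_linear v : linear (delta0_fun v).
Proof. by move=> a g h; rewrite /delta0_fun actDl actZl opprD scalerN. Qed.

HB.instance Definition _ v :=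
  GRing.isLinear.Build F L V *:%R (delta0_fun v) (delta0_linear v).

Definition delta0 v : {linear L -> V} := delta0_fun v.

Definition delta_cl psi g h : V :=
  - act g (psi h) + act h (psi g) + psi (lie g h).

Definition delta_p psi g : V := psi (ppow g) - iter p.-1 (act g) (psi g).

Definition delta1 psi : (L -> L -> V) * (L -> V) := (delta_cl psi, delta_p psi).

Lemma delta1B : {morph delta1 : psi psi' / psi - psi'}.
Proof.
move=> psi psi'; congr pair.
  apply/funext => g; apply/funext => h; rewrite /delta_cl !linBE !actBr.
  rewrite -[RHS]/(delta_cl psi g h - delta_cl psi' g h) /delta_cl !opprD.
  by rewrite [RHS]addrACA [X in _ = X + _]addrACA.
apply/funext => g; rewrite /delta_p !linBE.
have -> k x y : iter k (act g) (x - y) = iter k (act g) x - iter k (act g) y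
    :> V by elim: k => //= k ->; rewrite actBr.
by rewrite -[RHS]/(delta_p psi g - delta_p psi' g) /delta_p !opprD addrACA.
Qed.

Lemma delta1_delta0 v : delta1 (delta0 v) = 0.
Proof.
congr pair.
  apply/funext => g; apply/funext => h; rewrite /delta_cl /=.
  by rewrite /delta0_fun !linearN opprK act_lie subrr.
apply/funext => g; rewrite /delta_p /= /delta0_fun /= act_ppow.
have iterN k x : iter k (act g) (- x) = - iter k (act g) x :> V.
  by elim: k => //= k ->; rewrite linearN.
rewrite iterN -iterSr prednK ?(prime_gt0 (pcharf_prime charFp)) //.
exact: subrr.
Qed.

Lemma delta0B : {morph delta0 : v w / v - w}.
Proof.
by move=> v w; apply: linear_ext => g; rewrite linBE /= /delta0_fun actBr opprD.
Qed.

Definition cocycle_pred : {pred {linear L -> V}} :=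
  [pred psi | `[< delta1 psi = 0 >]].

Lemma cocycle_closed : zmod_closed cocycle_pred.
Proof.
split=> [|f g].
  by rewrite -(subrr 0); apply/asboolP; rewrite delta1B subrr.
by move=> /asboolP f0 /asboolP g0; apply/asboolP; rewrite delta1B f0 g0 subrr.
Qed.

HB.instance Definition _ :=
  GRing.isZmodClosed.Build _ cocycle_pred cocycle_closed.

Record cocycle := Cocycle {
  cocycle_val :> {linear L -> V};
  cocycleP : cocycle_val \in cocycle_pred
}.

HB.instance Definition _ := [isSub for cocycle_val].
HB.instance Definition _ := [Choice of cocycle by <:].
HB.instance Definition _ := [SubChoice_isSubZmodule of cocycle by <:].

(* The whole image of delta0, since it lies in the kernel of delta1 by
   delta1_delta0. *)
Definition coboundary : {pred cocycle} :=
  [pred z | `[< exists v, \val z = delta0 v >]].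

Lemma coboundary_closed : zmod_closed coboundary.
Proof.
split=> [|f g].
  apply/asboolP; exists 0.
  by rewrite -[in RHS](subrr 0) delta0B subrr raddf0.
move=> /asboolP[v fv] /asboolP[w gw]; apply/asboolP; exists (v - w).
by rewrite delta0B -fv -gw raddfB.
Qed.

HB.instance Definition _ :=
  GRing.isZmodClosed.Build _ coboundary coboundary_closed.

Definition H1 := @Quotient.quot cocycle coboundary.
HB.instance Definition _ := GRing.Zmodule.on H1.

Definition H1_class (z : cocycle) : H1 :=
  (\pi_(@Quotient.quot cocycle coboundary) z)%qT.

Lemma H1_classP (z z' : cocycle) :
  H1_class z = H1_class z' <->
  exists v, cocycle_val z - cocycle_val z' = delta0 v.
Proof.
split=> [/eqP|[v zv]]; last apply/eqP; rewrite eqmodE.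
  by move=> /asboolP[v zv]; exists v; rewrite -zv.
by apply/asboolP; exists v; rewrite -zv.
Qed.

End Cohomology.
Arguments H1 {F p charFp L} V.

Section Extensions.
Variables (F : fieldType) (p : nat) (charFp : p \in [pchar F]).
Variables (L : restrictedLieType charFp) (N M : restrictedModType L).

Record extension := Extension {
  ext_mod :> restrictedModType L;
  ext_iota : {linear M -> ext_mod};
  ext_pi : {linear ext_mod -> N};
  ext_iota_act : forall (g : L) m, ext_iota (act g m) = act g (ext_iota m);
  ext_pi_act : forall (g : L) e, ext_pi (act g e) = act g (ext_pi e);
  ext_iota_inj : injective ext_iota;
  ext_pi_surj : forall n, exists e, ext_pi e = n;
  ext_exact : forall e, ext_pi e = 0 <-> exists m, e = ext_iota m
}.

Definition ext_equiv (E1 E2 : extension) : Prop :=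
  exists f : {linear E1 -> E2},
    [/\ forall (g : L) e, f (act g e) = act g (f e),
        forall m, f (ext_iota E1 m) = ext_iota E2 m &
        forall e, ext_pi E2 (f e) = ext_pi E1 e].

Lemma ext_equiv_refl E : ext_equiv E E.
Proof. by exists idfun. Qed.

Lemma ext_equiv_trans E1 E2 E3 :
  ext_equiv E1 E2 -> ext_equiv E2 E3 -> ext_equiv E1 E3.
Proof.
move=> [f [fg fi fp]] [h [hg hi hp]]; exists (h \o f); split=> /= *.
- by rewrite fg hg.
- by rewrite fi hi.
- by rewrite hp fp.
Qed.

Lemma ext_equiv_sym E1 E2 : ext_equiv E1 E2 -> ext_equiv E2 E1.
Proof.
move=> [f [fg fi fp]].
have f_inj : injective f.
  apply: raddf_inj => x fx0.
  have /ext_exact[m xE] : ext_pi E1 x = 0 by rewrite -fp fx0 linear0.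
  move: fx0; rewrite xE /= fi -(linear0 (ext_iota E2)).
  by move=> /ext_iota_inj ->; rewrite linear0.
have f_surj y : exists x, f x = y.
  have [x xE] := @ext_pi_surj E1 (ext_pi E2 y).
  have /ext_exact[m yE] : ext_pi E2 (y - f x) = 0.
    by rewrite linearB /= fp xE subrr.
  by exists (x + ext_iota E1 m); rewrite linearD /= fi -yE addrC subrK.
pose h y := sval (cid (f_surj y)).
have hK : cancel h f by move=> y; exact: svalP (cid (f_surj y)).
have h_lin : linear h.
  by move=> a x y; apply: f_inj; rewrite linearP /= !hK.
pose hL : {linear E2 -> E1} :=
  HB.pack h (GRing.isLinear.Build F E2 E1 *:%R h h_lin).
exists hL; split=> /= *.
- by apply: f_inj; rewrite fg !hK.
- by apply: f_inj; rewrite fi hK.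
- by rewrite -fp hK.
Qed.

(* Classes are predicates rather than elements of an {eq_quot _}: extensions
   quantify over modules, so their type lives in a larger universe than the
   choiceTypes that {eq_quot _} is about. *)
Definition Ext : Type :=
  {C : extension -> Prop | exists E : extension, C = ext_equiv E}.

Definition Ext_class (E : extension) : Ext :=
  exist _ (ext_equiv E) (ex_intro _ E erefl).

Lemma Ext_classP E1 E2 : Ext_class E1 = Ext_class E2 <-> ext_equiv E1 E2.
Proof.
split=> [[->]|eqE]; first exact: ext_equiv_refl.
apply: eq_exist; apply/funext => E; apply/propext; split.
  exact/ext_equiv_trans/ext_equiv_sym.
exact: ext_equiv_trans.
Qed.

End Extensions.

(* Main.v *)
Require Import Defs.
From mathcomp Require Import all_boot all_algebra.
From mathcomp Require Import boolp classical_sets.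
From HB Require Import structures.
Import GRing.Theory.
Local Open Scope ring_scope.

Set Implicit Arguments.
Unset Strict Implicit.
Unset Printing Implicit Defensive.

(* For a linear section rho of E -> N, the cocycle psi is determined by
   iota \o psi g = g . rho in Hom(N, E), so the cocycle identities for psi are
   the module axioms of Hom(N, E) applied to rho.  Conversely a cocycle psi
   twists the action on M * N into g (m, n) = (g m + psi g n, g n); every E
   with cocycle psi receives an equivalence (m, n) |-> iota m + rho n from this
   twisted product.  Changing rho by iota \o v changes psi by the coboundary of
   v, so two extensions with cohomologous cocycles have sections with the same
   cocycle, hence are equivalent to the same twisted product. *)

(** * Linear maps from linear relations, and linear sections in arbitrary dimension *)

Section LinearAlgebra.
Variables (F : fieldType) (U V : lmodType F).

(** Subtracting two values related to the same [u] leaves a value related to [0], so a total linear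
    relation with trivial fibre over [0] is the graph of a linear map. *)
Lemma linear_of_rel (R : U -> V -> Prop) :
    (forall u, exists v, R u v) -> (forall v, R 0 v -> v = 0) ->
    (forall a u v u' v', R u v -> R u' v' -> R (a *: u + u') (a *: v + v')) ->
  exists f : {linear U -> V}, forall u, R u (f u).
Proof.
move=> Rtot R0 Rlin.
have Runiq u v v' : R u v -> R u v' -> v = v'.
  move=> Ruv Ruv'; have := Rlin (-1) _ _ _ _ Ruv Ruv'.
  by rewrite !scaleN1r addNr => /R0; rewrite addrC => /subr0_eq ->.
pose f u := sval (cid (Rtot u)).
have fP u : R u (f u) by exact: svalP (cid (Rtot u)).
have f_lin : linear f.
  by move=> a x y; apply: Runiq (fP _) _; apply: Rlin; exact: fP.
pose fL : {linear U -> V} :=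
  HB.pack f (GRing.isLinear.Build F U V *:%R f f_lin).
by exists fL; exact: fP.
Qed.

(** Zorn's lemma gives a maximal subspace [W] on which [f] is injective. Were [u] outside [f(W)],
    adjoining a preimage of [u] would keep injectivity; so [f] is bijective on [W], and [r] is the
    inverse. *)
Lemma linear_section (f : {linear V -> U}) :
  (forall u, exists v, f v = u) -> exists r : {linear U -> V}, cancel r f.
Proof.
move=> f_surj.
pose P (W : set V) := (forall a x y, W x -> W y -> W (a *: x + y)) /\
  (forall x, W x -> f x = 0 -> x = 0).
have [|W [[Wlin W0] Wmax]] := @Zorn_bigcup V P.
  move=> C CP Ctot; split=> [a x y [X CX Xx] [Y CY Yy]|x [X CX Xx]]; last first.
    by have [_] := CP _ CX; apply.
  have [XY|YX] := Ctot _ _ CX CY.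
    by exists Y => //; have [+ _] := CP _ CY; apply=> //; exact: XY.
  by exists X => //; have [+ _] := CP _ CX; apply=> //; exact: YX.
(* The empty set satisfies [P], as the empty chain requires; a maximal [W] cannot be empty, since
   [{0}] is larger. *)
have W00 : W 0.
  have [We|[x Wx]] : W = set0 \/ exists x, W x.
    by have [->|/set0P] := eqVneq W set0; [left|right].
    apply: contrapT => nW0; apply: (Wmax [set 0]%classic).
      by rewrite We; split=> [x []|/(_ 0 erefl)].
    by split=> [a x y /= -> ->|x /= ->]; rewrite ?scaler0 ?addr0.
  by have := Wlin (-1) _ _ Wx Wx; rewrite scaleN1r addNr.
have Wsurj u : exists v, W v /\ f v = u.
  apply: contrapT => nu; have [e eu] := f_surj u.
  pose B : set V := [set x | exists w a, W w /\ x = w + a *: e]%classic.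
  have WB w : W w -> B w by exists w, 0; rewrite scale0r addr0.
  apply: (Wmax B).
    split=> [w /WB //|BW]; apply: nu; exists e; split=> //.
    by apply: BW; exists 0, 1; rewrite add0r scale1r.
  split=> [a x y [w [b [Ww ->]]] [w' [b' [Ww' ->]]]|x [w [b [Ww ->]]]].
    exists (a *: w + w'), (a * b + b'); split; first exact: Wlin.
    by rewrite scalerDr scalerDl scalerA addrACA.
  rewrite linearD linearZ /= eu => wb0.
  have [b0|b0] := eqVneq b 0.
    move: wb0; rewrite b0 !scale0r !addr0; exact: W0.
  (* From [f w + b *: u = 0] with [b] nonzero, [u] is the image of [- b^-1 *: w]. The summand [0]
     fits the shape of [Wlin]. *)
  exfalso; apply: nu; exists (- b^-1 *: w + 0); split; first exact: Wlin.
  rewrite addr0 linearZ /=; have -> : f w = - (b *: u)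
    by apply/eqP; rewrite -addr_eq0; apply/eqP.
  by rewrite scaleNr scalerN opprK scalerA mulVf // scale1r.
have [|||r rP] := @linear_of_rel (fun u v => W v /\ f v = u).
- exact: Wsurj.
- by move=> v [Wv]; exact: W0.
- move=> a u v u' v' [Wv <-] [Wv' <-]; split; first exact: Wlin.
  by rewrite linearP.
by exists r => u; have [] := rP u.
Qed.

End LinearAlgebra.

(** For [0 < j < p], Pascal's rule and [p] dividing ['C(p, j)] give ['C(p.-1, j) = - 'C(p.-1, j.-1)]
    in [F]; the signs then cancel by induction. *)
Lemma sign_bin_pchar (F : fieldType) (p i : nat) :
  p \in [pchar F] -> (i < p)%N -> (-1) ^+ i *+ 'C(p.-1, i) = 1 :> F.
Proof.
move=> charFp; have p_pr := pcharf_prime charFp.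
elim: i => [|i IHi] ltip; first by rewrite expr0 bin0.
have: (('C(p, i.+1))%:R : F) = 0.
  by apply/eqP; rewrite -(dvdn_pcharf charFp) prime_dvd_bin.
rewrite -[X in 'C(X, _)](prednK (prime_gt0 p_pr)) binS natrD => /eqP.
rewrite addr_eq0 => /eqP binE.
by rewrite -mulr_natr binE exprS mulN1r mulrNN mulr_natr IHi // ltnW.
Qed.

(** * The cocycle identities evaluated at a vector of [N] *)

Section Cocycles.
Variables (F : fieldType) (p : nat) (charFp : p \in [pchar F]).
Variables (L : restrictedLieType charFp) (M N : restrictedModType L).
Implicit Types (E : extension N M) (psi : cocycle {linear N -> M}).
Implicit Types (g h : L).

Lemma cocycle_lie psi g h n : psi (lie g h) n =
  act g (psi h n) - psi h (act g n) - (act h (psi g n) - psi g (act h n)).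
Proof.
have /asboolP[+ _] := cocycleP psi.
move=> /(congr1 (fun d : L -> L -> {linear N -> M} => d g h n)) d0.
apply/eqP; rewrite -subr_eq0; apply/eqP; rewrite -[RHS]d0 /delta_cl.
by rewrite !linDE linNE !act_homE [RHS]addrC [in LHS]opprD [- - _]opprK.
Qed.

(** The sum is the [p.-1]-fold action of [g] on [psi g] in Hom(N, M), whose signed binomial
    coefficients are all 1 in characteristic [p]. *)
Lemma cocycle_ppow psi g n : psi (ppow g) n =
  \sum_(i < p) iter (p.-1 - i) (act g) (psi g (iter i (act g) n)).
Proof.
have /asboolP[_ +] := cocycleP psi.
move=> /(congr1 (fun d : L -> {linear N -> M} => d g n)) d0.
have p_gt0 := prime_gt0 (pcharf_prime charFp).
have -> : psi (ppow g) n = iter p.-1 (act g) (psi g) n.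
  by apply/eqP; rewrite -subr_eq0; apply/eqP; exact: d0.
rewrite iter_act_sum prednK //; apply: eq_bigr => i _.
by rewrite (sign_bin_pchar charFp) // scale1r.
Qed.

(** * The cocycle of an extension with a linear section *)

Definition is_ext_cocycle E (rho : {linear N -> E}) psi :=
  forall g n, ext_iota E (psi g n) = act g (rho n) - rho (act g n).

Lemma ext_cocycle_exists E (rho : {linear N -> E}) :
  cancel rho (ext_pi E) -> exists psi, is_ext_cocycle rho psi.
Proof.
move=> rhoK; pose R g (phi : {linear N -> M}) :=
  forall n, ext_iota E (phi n) = act g (rho n) - rho (act g n).
have iota0 m : ext_iota E m = 0 -> m = 0.
  by move=> m0; apply: (@ext_iota_inj _ _ _ _ _ _ E); rewrite linear0.
have [|||psi psiP] := @linear_of_rel F L {linear N -> M} R.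
- move=> g; have [|||f fP] := @linear_of_rel F N M
    (fun n m => ext_iota E m = act g (rho n) - rho (act g n)).
  + move=> n; have /ext_exact[m ->] :
      ext_pi E (act g (rho n) - rho (act g n)) = 0.
      by rewrite linearB /= ext_pi_act !rhoK subrr.
    by exists m.
  + by move=> m; rewrite !linear0 addr0; exact: iota0.
  + by move=> a n m n' m' nm nm'; rewrite !linearP /= nm nm' scalerDr addrACA.
  by exists f.
- move=> phi phi0; apply: linear_ext => n; rewrite lin0E; apply: iota0.
  by rewrite phi0 !act0l linear0 subrr.
- move=> a g phi g' phi' Rg Rg' n; rewrite linDE linZE linearP /= Rg Rg'.
  by rewrite !actDl !actZl !linearP /= scalerDr addrACA.
(* [post] embeds Hom(N, M) equivariantly in Hom(N, E), so both cocycle identities may be checked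
   after applying it. *)
pose post (phi : {linear N -> M}) : {linear N -> E} := ext_iota E \o phi.
have postD phi phi' : post (phi + phi') = post phi + post phi'.
  by apply: linear_ext => n; exact: linearD.
have postN phi : post (- phi) = - post phi.
  by apply: linear_ext => n; exact: linearN.
have post0 phi : post phi = 0 -> phi = 0.
  by move=> phi0; apply: linear_ext => n; apply: iota0;
    rewrite -[RHS](lin0E E n) -phi0.
have psiE g : post (psi g) = act g rho.
  by apply: linear_ext => n; rewrite act_homE -psiP.
have post_act g (phi : {linear N -> M}) : post (act g phi) = act g (post phi).
  by apply: linear_ext => n /=; rewrite !act_homE linearB /= ext_iota_act.
have psi_coc : psi \in @cocycle_pred _ _ _ _ {linear N -> M}.
  apply/asboolP; congr pair.
    apply/funext => g; apply/funext => h; apply: post0.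
    rewrite /delta_cl !postD postN !post_act !psiE act_lie.
    by rewrite addrCA addrA addNKr subrr.
  apply/funext => g; apply: post0.
  (* [post (psi g)] already contains one action of [g], so [p.-1] further ones give the [p]-fold
     action of [g] on [rho], which is that of [ppow g]. *)
  have post_iter k : post (iter k (act g) (psi g)) = iter k.+1 (act g) rho.
    by elim: k => [|k IHk]; rewrite ?psiE // [LHS]post_act IHk.
  rewrite /delta_p postD postN psiE post_iter.
  by rewrite prednK ?(prime_gt0 (pcharf_prime charFp)) // act_ppow subrr.
by exists (Cocycle psi_coc).
Qed.

(** Two sections differ by a map into the kernel of [ext_pi E], hence by [ext_iota E \o v] for a
    linear [v : N -> M]. *)
Lemma ext_cocycle_cohomologous E (rho rho' : {linear N -> E}) psi psi' :
    cancel rho (ext_pi E) -> cancel rho' (ext_pi E) ->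
    is_ext_cocycle rho psi -> is_ext_cocycle rho' psi' ->
  H1_class psi = H1_class psi'.
Proof.
move=> rhoK rhoK' rhoP rhoP'.
have [|||v vP] := @linear_of_rel F N M
  (fun n m => ext_iota E m = rho' n - rho n).
- move=> n; have /ext_exact[m ->] : ext_pi E (rho' n - rho n) = 0.
    by rewrite linearB /= rhoK rhoK' subrr.
  by exists m.
- move=> m; rewrite !linear0 addr0 => m0.
  by apply: (@ext_iota_inj _ _ _ _ _ _ E); rewrite linear0.
- by move=> a n m n' m' nm nm'; rewrite !linearP /= nm nm' scalerDr addrACA.
apply/H1_classP; exists v; apply: linear_ext => g; apply: linear_ext => n.
(* As [delta0 v g] is [- act g v], this says that [psi - psi'] is [delta0 v]. *)
have psiE : psi' g n = psi g n + act g v n.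
  apply: (@ext_iota_inj _ _ _ _ _ _ E).
  rewrite linearD act_homE linearB /= ext_iota_act rhoP rhoP' !vP actBr.
  rewrite (opprD (rho' _)) (addrACA (act g (rho' n))) -opprD.
  by rewrite [RHS]addrC subrK.
by rewrite !linBE psiE opprD addNKr.
Qed.

(** * The twisted product of a cocycle *)

Lemma iter_act_twisted psi g k m n :
    iter k (fun x : M * N => (act g x.1 + psi g x.2, act g x.2)) (m, n) =
  (iter k (act g) m +
     \sum_(i < k) iter (k.-1 - i) (act g) (psi g (iter i (act g) n)),
   iter k (act g) n).
Proof.
(* The [i]-th application adds [psi g] at the [i]-th iterate of [n]; the remaining [k.-1 - i]
   applications then act on that term. *)
elim: k => [|k IHk]; first by rewrite big_ord0 addr0.
rewrite !iterS IHk /=; congr pair.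
rewrite linearD /= -addrA; congr (_ + _).
rewrite big_ord_recr /= subnn linear_sum; congr (_ + _).
apply: eq_bigr => -[i ltik] _; case: k ltik {IHk} => //= k ltik.
by rewrite -iterS -subSn.
Qed.

Section TwistedProduct.
Variable psi : cocycle {linear N -> M}.

Definition twisted : Type := (M * N)%type.
HB.instance Definition _ := GRing.Lmodule.on twisted.

Definition twisted_act g (x : twisted) : twisted :=
  (act g x.1 + psi g x.2, act g x.2).

Lemma twisted_act_linearl x : linear (twisted_act^~ x).
Proof.
move=> a g h; congr pair; last by rewrite actDl actZl.
by rewrite /= actDl actZl linearP linDE linZE scalerDr addrACA.
Qed.

Lemma twisted_act_linearr g : linear (twisted_act g).
Proof.
move=> a x y; congr pair; last by rewrite /= linearP.
by rewrite /= !linearP /= scalerDr addrACA.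
Qed.

(** In the [M]-component the terms in [psi] agree by [cocycle_lie]. *)
Lemma twisted_act_lie g h x : twisted_act (lie g h) x =
  twisted_act g (twisted_act h x) - twisted_act h (twisted_act g x).
Proof.
congr pair; last by rewrite /= act_lie.
rewrite /= act_lie cocycle_lie !linearD /= opprK.
rewrite [RHS]addrACA [X in _ = X + _]addrACA -[RHS]addrA; congr (_ + _).
by rewrite addrACA [- _ + _]addrC.
Qed.

HB.instance Definition _ := isLieModule.Build F L twisted
  twisted_act_linearl twisted_act_linearr twisted_act_lie.

(** Iterating [p] times adds exactly the sum that [cocycle_ppow] identifies with
    [psi (ppow g) n]. *)
Lemma twisted_act_ppow g (x : twisted) : act (ppow g) x = iter p (act g) x.
Proof.
case: x => m n; rewrite [RHS]iter_act_twisted -cocycle_ppow.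
by congr pair; rewrite /= act_ppow.
Qed.

HB.instance Definition _ :=
  isRestrictedModule.Build F p charFp L twisted twisted_act_ppow.

Definition twisted_iota (m : M) : twisted := (m, 0).
Lemma twisted_iota_linear : linear twisted_iota.
Proof. by move=> a m m'; congr pair; rewrite /= scaler0 addr0. Qed.
HB.instance Definition _ :=
  GRing.isLinear.Build F M twisted *:%R twisted_iota twisted_iota_linear.

Definition twisted_pi (x : twisted) : N := x.2.
Lemma twisted_pi_linear : linear twisted_pi. Proof. by []. Qed.
HB.instance Definition _ :=
  GRing.isLinear.Build F twisted N *:%R twisted_pi twisted_pi_linear.

Definition twisted_rho (n : N) : twisted := (0, n).
Lemma twisted_rho_linear : linear twisted_rho.
Proof. by move=> a n n'; congr pair; rewrite /= scaler0 addr0. Qed.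
HB.instance Definition _ :=
  GRing.isLinear.Build F N twisted *:%R twisted_rho twisted_rho_linear.

Lemma twisted_iota_act g m : twisted_iota (act g m) = act g (twisted_iota m).
Proof. by congr pair; rewrite /= ?linear0 ?addr0. Qed.

Lemma twisted_pi_act g x : twisted_pi (act g x) = act g (twisted_pi x).
Proof. by []. Qed.

Lemma twisted_iota_inj : injective twisted_iota.
Proof. by move=> m m' []. Qed.

Lemma twisted_pi_surj n : exists x, twisted_pi x = n.
Proof. by exists (twisted_rho n). Qed.

Lemma twisted_exact x : twisted_pi x = 0 <-> exists m, x = twisted_iota m.
Proof.
by split=> [|[m ->]] //; case: x => m n; rewrite /twisted_pi /= => ->; exists m.
Qed.

Definition twisted_ext : extension N M :=
  @Extension F p charFp L N M twisted twisted_iota twisted_pi twisted_iota_act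
    twisted_pi_act twisted_iota_inj twisted_pi_surj twisted_exact.

(** [g (0, n) - (0, g n) = (psi g n, 0)]; hence every cocycle comes from an extension. *)
Lemma twisted_ext_cocycle :
  @is_ext_cocycle twisted_ext twisted_rho psi.
Proof.
move=> g n; congr pair; rewrite /=; last by rewrite subrr.
by rewrite linear0 add0r subr0.
Qed.

Lemma twisted_ext_equiv E (rho : {linear N -> E}) :
    cancel rho (ext_pi E) -> is_ext_cocycle rho psi ->
  ext_equiv twisted_ext E.
Proof.
move=> rhoK rhoP; pose f (x : twisted) := ext_iota E x.1 + rho x.2.
have f_lin : linear f.
  by move=> a x y; rewrite /f !linearP /= scalerDr addrACA.
pose fL : {linear twisted -> E} :=
  HB.pack f (GRing.isLinear.Build F twisted E *:%R f f_lin).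
exists fL; split=> [g x|m|x] /=; rewrite /f /=.
- by rewrite linearD /= rhoP ext_iota_act linearD /= -addrA subrK.
- by rewrite linear0 addr0.
- have pi0 m : ext_pi E (ext_iota E m) = 0 by apply/ext_exact; exists m.
  by rewrite linearD /= pi0 add0r rhoK.
Qed.

End TwistedProduct.

(** * Equivalence of extensions against equality of cohomology classes *)

Lemma ext_equiv_of_cohomologous E E' (rho : {linear N -> E})
    (rho' : {linear N -> E'}) psi psi' :
    cancel rho (ext_pi E) -> cancel rho' (ext_pi E') ->
    is_ext_cocycle rho psi -> is_ext_cocycle rho' psi' ->
  H1_class psi = H1_class psi' -> ext_equiv E E'.
Proof.
move=> rhoK rhoK' rhoP rhoP' /H1_classP[v psiE].
apply: (@ext_equiv_trans _ _ _ _ _ _ _ (twisted_ext psi)).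
  exact/ext_equiv_sym/(twisted_ext_equiv rhoK).
pose iv : {linear N -> E'} := ext_iota E' \o v.
(* Here [psi g = psi' g - act g v], so subtracting [iv] from [rho'] gives a section of [E'] with
   cocycle [psi]. *)
apply: (@twisted_ext_equiv psi E' (rho' - iv)) => [n|g n].
  have iv0 : ext_pi E' (iv n) = 0 by apply/ext_exact; exists (v n).
  by rewrite linBE linearB /= iv0 subr0.
have -> : psi g n = psi' g n - act g v n.
  have /(congr1 (fun d : {linear L -> {linear N -> M}} => d g n)) := psiE.
  by rewrite !linBE => /eqP; rewrite subr_eq addrC => /eqP.
rewrite linearB /= rhoP' act_homE linearB /= actBr ext_iota_act.
by rewrite !opprD [LHS]addrACA.
Qed.

(** An equivalence [f] is equivariant and the identity on [M], so [f \o rho] is a section of [E']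
    with the same cocycle as [rho]; it is then compared with [rho']. *)
Lemma ext_equiv_cohomologous E E' (rho : {linear N -> E})
    (rho' : {linear N -> E'}) psi psi' :
    cancel rho (ext_pi E) -> cancel rho' (ext_pi E') ->
    is_ext_cocycle rho psi -> is_ext_cocycle rho' psi' ->
  ext_equiv E E' -> H1_class psi = H1_class psi'.
Proof.
move=> rhoK rhoK' rhoP rhoP' [f [f_act f_iota f_pi]].
apply: (@ext_cocycle_cohomologous E' (f \o rho) rho') => // [n|g n] /=.
  by rewrite f_pi.
by rewrite -f_iota rhoP linearB f_act.
Qed.

End Cocycles.

Theorem theorem3p20 (F : fieldType) (p : nat) (charFp : p \in [pchar F])
    (L : restrictedLieType charFp) (M N : restrictedModType L) :
  exists Phi : Ext N M -> H1 {linear N -> M},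
    bijective Phi /\
    forall (E : extension N M) (rho : {linear N -> E}),
      cancel rho (ext_pi E) ->
      exists2 psi : cocycle {linear N -> M},
        forall (g : L) (n : N),
          ext_iota E (psi g n) = act g (rho n) - rho (act g n)
        & Phi (Ext_class E) = H1_class psi.
Proof.
(* [R] allows every representative, section and cocycle. Once it is shown total and functional, the
   chosen [Phi] is independent of these choices. *)
pose R (C : Ext N M) (c : H1 {linear N -> M}) :=
  exists (E : extension N M) (rho : {linear N -> E}) psi,
  [/\ C = Ext_class E, cancel rho (ext_pi E), is_ext_cocycle rho psi
    & c = H1_class psi].
have Rtot C : exists c, R C c.
  case: C => C [E EC]; subst C.
  have [rho rhoK] := linear_section (@ext_pi_surj _ _ _ _ _ _ E).
  have [psi psiP] := ext_cocycle_exists rhoK.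
  by exists (H1_class psi), E, rho, psi.
have Rfun C c c' : R C c -> R C c' -> c = c'.
  move=> [E [rho [psi [-> rhoK rhoP ->]]]]
    [E' [rho' [psi' [EE' rhoK' rhoP' ->]]]].
  by apply: (ext_equiv_cohomologous rhoK rhoK' rhoP rhoP'); exact/Ext_classP.
have Rinj C C' c : R C c -> R C' c -> C = C'.
  move=> [E [rho [psi [-> rhoK rhoP ->]]]]
    [E' [rho' [psi' [-> rhoK' rhoP' cc']]]].
  apply/Ext_classP.
  exact: (ext_equiv_of_cohomologous rhoK rhoK' rhoP rhoP').
have Rsurj c : R (Ext_class (twisted_ext (repr c))) c.
  exists (twisted_ext (repr c)), (@twisted_rho _ _ _ _ M N), (repr c).
  split=> //.
    exact: twisted_ext_cocycle.
  by rewrite /H1_class reprK.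
pose Phi C := sval (cid (Rtot C)).
have PhiP C : R C (Phi C) by exact: svalP (cid (Rtot C)).
exists Phi; split.
  (* The inverse twists by a representative cocycle; the two cancellations are injectivity and
     functionality of [R]. *)
  exists (fun c => Ext_class (twisted_ext (repr c))) => [C|c].
    exact: Rinj (Rsurj _) (PhiP C).
  exact: Rfun (PhiP _) (Rsurj c).
move=> E rho rhoK; have [psi psiP] := ext_cocycle_exists rhoK.
by exists psi => //; apply: Rfun (PhiP _) _; exists E, rho, psi.
Qed.
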